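(* Let $\mathcal{C}\subseteq\mathbb{F}[z]^n$ be an $(n,k,\delta)$ convolutional code over $\mathbb{F}=\mathbb{F}_q$ with minimal encoder $G$, controller canonical form $(A,B,C,D)$ and adjacency matrix $\Lambda=\Lambda(G)$. Let $\widehat{\mathcal{C}}$ be the dual code, with minimal encoder $\widehat{G}$, controller canonical form $(\widehat A,\widehat B,\widehat C,\widehat D)$ and adjacency matrix $\widehat\Lambda=\Lambda(\widehat G)=(\widehat\lambda_{X,Y})$. Suppose $\delta=r$, that is, each Forney index of $\mathcal{C}$ is at most $1$. Then $P:=-\widehat C D^tB\in \mathrm{GL}_{\delta}(\mathbb{F})$ and \[ \widehat\lambda_{X,Y}=q^{-k}\,\mathbf{H}\big((\mathcal{H}\Lambda^t\mathcal{H}^{-1})_{XP,YP}\big)\quad\text{for all }(X,Y)\in\mathbb{F}^\delta\times\mathbb{F}^\delta . \] In other words, \[ \widehat\Lambda=q^{-k}\,\mathbf{H}\big(\mathcal{P}(P)\mathcal{H}\Lambda^t\mathcal{H}^{-1}\mathcal{P}(P)^{-1}\big), \] where $\mathbf{H}$ is applied entrywise.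
   Context: Let $\mathbb{F}=\mathbb{F}_q$ be a finite field with $q=p^s$ elements ($p$ prime, $s\in\mathbb{N}$). Vectors are row vectors. Convolutional codes. A $k$-dimensional convolutional code of length $n$ is a submodule $\mathcal{C}=\{uG\mid u\in\mathbb{F}[z]^k\}$ of $\mathbb{F}[z]^n$ where $G\in\mathbb{F}[z]^{k\times n}$ is basic, i.e. $G\tilde G=I_k$ for some $\tilde G\in\mathbb{F}[z]^{n\times k}$; $G$ is called an encoder. The degree $\delta$ of $\mathcal{C}$ is the maximal degree of the $k$-minors of $G$; then $\mathcal{C}$ is an $(n,k,\delta)$ code. An encoder with rows $g_1,\dots,g_k$ is minimal if $\sum_i\deg g_i=\delta$; every code has a minimal encoder, and its row degrees, unique up to ordering, are the Forney indices of $\mathcal{C}$. The dual code is $\widehat{\mathcal{C}}=\{w\in\mathbb{F}[z]^n\mid \sum_j w_jv_j=0\ \forall v\in\mathcal{C}\}$; it is an $(n,n-k,\delta)$ code. Controller canonical form. Let $G$ be a minimal encoder with rows $g_i=\sum_{\nu=0}^{\delta_i}g_{i,\nu}z^\nu$ ($g_{i,\nu}\in\mathbb{F}^n$), ordered so that $\delta_1,\dots,\delta_r>0=\delta_{r+1}=\dots=\delta_k$; thus $r$ is the number of nonzero Forney indices of $\mathcal{C}$. For $i\le r$ let $A_i\in\mathbb{F}^{\delta_i\times\delta_i}$ have ones on the first superdiagonal and zeros elsewhere, $B_i=(1,0,\dots,0)\in\mathbb{F}^{\delta_i}$, and let $C_i\in\mathbb{F}^{\delta_i\times n}$ have rows $g_{i,1},\dots,g_{i,\delta_i}$.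 Then $A=\mathrm{diag}(A_1,\dots,A_r)\in\mathbb{F}^{\delta\times\delta}$, $B=\begin{pmatrix}\mathrm{diag}(B_1,\dots,B_r)\\0\end{pmatrix}\in\mathbb{F}^{k\times\delta}$, $C\in\mathbb{F}^{\delta\times n}$ is the vertical stack of $C_1,\dots,C_r$, and $D=G(0)\in\mathbb{F}^{k\times n}$. The same definitions are applied to $\widehat{\mathcal{C}}$ with a minimal encoder $\widehat G\in\mathbb{F}[z]^{(n-k)\times n}$. Adjacency matrix. For finite $S\subseteq\mathbb{F}^n$, $\mathrm{we}(S)=\sum_{a\in S}W^{\mathrm{wt}(a)}\in\mathbb{C}[W]_{\le n}$ (polynomials of degree at most $n$), with $\mathrm{wt}$ the Hamming weight and $\mathrm{we}(\emptyset)=0$. $\Lambda(G)=(\lambda_{X,Y})\in\mathbb{C}[W]^{q^\delta\times q^\delta}$ is indexed by $(X,Y)\in\mathbb{F}^\delta\times\mathbb{F}^\delta$ with $\lambda_{X,Y}=\mathrm{we}(\{XC+uD\mid u\in\mathbb{F}^k,\ Y=XA+uB\})$; $\Lambda(\widehat G)$ is defined analogously from $(\widehat A,\widehat B,\widehat C,\widehat D)$ with $u\in\mathbb{F}^{n-k}$. MacWilliams objects. $\mathbf{H}:\mathbb{C}[W]_{\le n}\to\mathbb{C}[W]_{\le n}$, $\mathbf{H}(f)(W)=(1+(q-1)W)^n f\big(\tfrac{1-W}{1+(q-1)W}\big)$. Fix a primitive $p$-th root of unity $\zeta\in\mathbb{C}$, let $\tau:\mathbb{F}\to\mathbb{F}_p$,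 $\tau(a)=\sum_{i=0}^{s-1}a^{p^i}$ be the trace and $\beta(X,Y)=\sum_jX_jY_j$. Then $\mathcal{H}=q^{-\delta/2}\big(\zeta^{\tau(\beta(X,Y))}\big)_{X,Y\in\mathbb{F}^\delta}\in\mathbb{C}^{q^\delta\times q^\delta}$ (an invertible matrix). For $P\in\mathrm{GL}_\delta(\mathbb{F})$, $\mathcal{P}(P)\in\mathrm{GL}_{q^\delta}(\mathbb{C})$ is the permutation matrix with $\mathcal{P}(P)_{X,Y}=1$ if $Y=XP$ and $0$ otherwise. *)

(* Defs.v *)
From mathcomp Require Import all_boot all_order all_algebra all_field.
From mathcomp Require Import complex reals.

Set Implicit Arguments.
Unset Strict Implicit.
Unset Printing Implicit Defensive.

Import Order.TTheory GRing.Theory Num.Theory.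
Local Open Scope ring_scope.

Section ConvolutionalCodes.

Variables (F : finFieldType) (n : nat).

Definition basic k (G : 'M[{poly F}]_(k, n)) : Prop :=
  exists Gt : 'M[{poly F}]_(n, k), G *m Gt = 1%:M.

Definition encoder k (C : 'rV[{poly F}]_n -> Prop) (G : 'M[{poly F}]_(k, n)) :
    Prop :=
  basic G /\ forall v, C v <-> exists u : 'rV[{poly F}]_k, v = u *m G.

Definition increasing k (f : {ffun 'I_k -> 'I_n}) : bool :=
  [forall a : 'I_k, forall b : 'I_k, (a < b)%N ==> (f a < f b)%N].

(* Two encoders of the same code differ by a unimodular left factor, so for an
   encoder this number depends on the code only. *)
Definition minor_degree k (G : 'M[{poly F}]_(k, n)) : nat :=
  (\max_(f : {ffun 'I_k -> 'I_n} | increasing f)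
    (size (\det (colsub f G))).-1)%N.

Definition conv_code (k delta : nat) (C : 'rV[{poly F}]_n -> Prop) : Prop :=
  exists G : 'M[{poly F}]_(k, n), encoder C G /\ minor_degree G = delta.

Definition dual_code (C : 'rV[{poly F}]_n -> Prop) : 'rV[{poly F}]_n -> Prop :=
  fun w => forall v, C v -> \sum_j w 0 j * v 0 j = 0.

Definition row_degree k (G : 'M[{poly F}]_(k, n)) (i : 'I_k) : nat :=
  (\max_(j < n) (size (G i j)).-1)%N.

Definition minimal_encoder k (C : 'rV[{poly F}]_n -> Prop)
    (G : 'M[{poly F}]_(k, n)) : Prop :=
  encoder C G /\ (\sum_(i < k) row_degree G i)%N = minor_degree G.

Definition zero_degrees_last k (G : 'M[{poly F}]_(k, n)) : Prop :=
  forall i j : 'I_k,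
    (i <= j)%N -> (0 < row_degree G j)%N -> (0 < row_degree G i)%N.

Definition num_nonzero_degrees k (G : 'M[{poly F}]_(k, n)) : nat :=
  #|[set i : 'I_k | (0 < row_degree G i)%N]|.

(* The block matrices below have state dimension \sum_i row_degree G i, which
   equals the degree delta of the code when G is minimal; conform_mx only
   transports them along that equality (it returns its default 0 when the
   dimensions differ).  Rows of degree 0 contribute blocks of size 0. *)
Definition ccf_A (delta : nat) k (G : 'M[{poly F}]_(k, n)) : 'M[F]_delta :=
  conform_mx 0 (\mxdiag_(i < k)
    (\matrix_(a < row_degree G i, b < row_degree G i) (a.+1 == b :> nat)%:R)).

(* Block column i has the row (1, 0, ..., 0) in position i and is 0 elsewhere;
   when the rows of degree 0 come last, this is diag(B_1, ..., B_r) stacked on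
   top of 0. *)
Definition ccf_B (delta : nat) k (G : 'M[{poly F}]_(k, n)) :
    'M[F]_(k, delta) :=
  conform_mx 0 (\mxrow_(i < k)
    (\matrix_(l < k, b < row_degree G i) ((l == i) && (b == 0 :> nat))%:R)).

Definition ccf_C (delta : nat) k (G : 'M[{poly F}]_(k, n)) :
    'M[F]_(delta, n) :=
  conform_mx 0 (\mxcol_(i < k)
    (\matrix_(a < row_degree G i, j < n) (G i j)`_a.+1)).

Definition ccf_D k (G : 'M[{poly F}]_(k, n)) : 'M[F]_(k, n) :=
  map_mx (fun f : {poly F} => f.[0]) G.

End ConvolutionalCodes.

(* A family indexed by F^delta x F^delta, as a matrix. *)
Definition mx_of_states (F : finFieldType) (delta : nat) (T : Type)
    (f : 'rV[F]_delta -> 'rV[F]_delta -> T) :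
    'M[T]_(#|{: 'rV[F]_delta}|) :=
  \matrix_(a, b) f (enum_val a) (enum_val b).

Definition entry (F : finFieldType) (delta : nat) (T : Type)
    (M : 'M[T]_(#|{: 'rV[F]_delta}|)) (X Y : 'rV[F]_delta) : T :=
  M (enum_rank X) (enum_rank Y).

Section Weights.

Variables (K : numClosedFieldType) (F : finFieldType).

Definition wt n (a : 'rV[F]_n) : nat := #|[set j | a 0 j != 0]|.

Definition we n (S : {set 'rV[F]_n}) : {poly K} := \sum_(a in S) 'X^(wt a).

Definition adjacency (delta k n : nat) (A : 'M[F]_delta) (B : 'M[F]_(k, delta))
    (C : 'M[F]_(delta, n)) (D : 'M[F]_(k, n)) :
    'M[{poly K}]_(#|{: 'rV[F]_delta}|) :=
  mx_of_states (fun X Y =>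
    we [set X *m C + u *m D | u : 'rV[F]_k & Y == X *m A + u *m B]).

Definition Lambda (delta k n : nat) (G : 'M[{poly F}]_(k, n)) :
    'M[{poly K}]_(#|{: 'rV[F]_delta}|) :=
  adjacency (ccf_A delta G) (ccf_B delta G) (ccf_C delta G) (ccf_D G).

(* (1 + (q-1)W)^n f((1-W)/(1 + (q-1)W)) with the denominators cleared, for f of
   degree at most n; see MacWilliamsE. *)
Definition MacWilliams (n : nat) (f : {poly K}) : {poly K} :=
  \sum_(i < n.+1)
    f`_i *: ((1 - 'X) ^+ i * (1 + (#|F|%:R - 1) *: 'X) ^+ (n - i)).

Lemma MacWilliamsE n (f : {poly K}) : (size f <= n.+1)%N ->
  let N := tofrac (1 - 'X : {poly K}) in
  let M := tofrac (1 + (#|F|%:R - 1) *: 'X : {poly K}) in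
  tofrac (MacWilliams n f) = M ^+ n * (map_poly (@tofrac _ \o polyC) f).[N / M].
Proof.
move=> szf N M.
have sz1 (c : K) : (1 + c *: 'X : {poly K}) != 0.
  apply/eqP => /(congr1 (fun r : {poly K} => r.[0])).
  by rewrite !hornerE /= => /eqP; rewrite oner_eq0.
have M0 : M != 0 by rewrite tofrac_eq0 sz1.
have szm : (size (map_poly (@tofrac _ \o polyC) f) <= n.+1)%N.
  by rewrite size_map_poly.
rewrite (horner_coef_wide _ szm) mulr_sumr rmorph_sum /=.
apply: eq_bigr => i _; rewrite coef_map /= -mul_polyC !rmorphM !rmorphXn /=.
rewrite [RHS]mulrCA; congr (_ * _).
have lei : (i <= n)%N by rewrite -ltnS.
rewrite -/N -/M expr_div_n [RHS]mulrCA; congr (_ * _).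
by rewrite expfB_cond // ?(negbTE M0) // add0n.
Qed.

(* The sum of conjugates lies in the prime subfield, whose elements are the
   m%:R for m < p; this is the representative m of the trace. *)
Definition trace_rep (p s : nat) (a : F) : nat :=
  if [pick m : 'I_p | m%:R == \sum_(i < s) a ^+ (p ^ i)] is Some m
  then m : nat else 0%N.

Definition beta (delta : nat) (X Y : 'rV[F]_delta) : F :=
  \sum_j X 0 j * Y 0 j.

Definition Hmx (p s : nat) (zeta : K) (delta : nat) :
    'M[K]_(#|{: 'rV[F]_delta}|) :=
  sqrtC (#|F|%:R) ^- delta *:
    mx_of_states (fun X Y : 'rV[F]_delta => zeta ^+ trace_rep p s (beta X Y)).

Definition Pmx (delta : nat) (P : 'M[F]_delta) :
    'M[K]_(#|{: 'rV[F]_delta}|) :=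
  mx_of_states (fun X Y : 'rV[F]_delta => (Y == X *m P)%:R).

End Weights.

(* Main.v *)
(** When every Forney index of C is at most 1 the controller form has A = 0, so
    Lambda enumerates the words VC + uD with uB = U. Summing characters over the
    parameters (V, u), the MacWilliams transform of H Lambda^t H^-1 at (X, Y)
    becomes q^k times the weight enumerator of the affine space
    { x | x D^t = - X B^t, x C^t = Y }. On the other side, the coefficients of
    the identity Gh G^t = 0 show that the output XCh + uDh of the dual code with
    next state Y satisfies these equations at (XP, YP); the converse inclusion
    holds as soon as P is invertible.

    P is invertible because X Ch D^t = 0 makes the polynomial part w of
    (sum_x X_x z^-(r x + 1) e_(i x)) Gh orthogonal to G, hence w = u Gh, and the
    predictable degree property of the minimal encoder Gh forces X = 0. The same
    property for G gives injectivity of the transpose, so that the two codes have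
    state spaces of the same dimension. *)
Require Import Defs.
From mathcomp Require Import all_boot all_order all_fingroup all_algebra.
From mathcomp Require Import all_field.
From mathcomp Require Import complex reals ring zify.
Import Order.TTheory GRing.Theory Num.Theory.
Local Open Scope ring_scope.
Set Implicit Arguments.
Unset Strict Implicit.
Unset Printing Implicit Defensive.

(** * Matrices indexed by pairs of states *)

Section StateMatrices.

Variables (F : finFieldType) (delta : nat).
Local Notation state := 'rV[F]_delta.

Lemma entry_mx_of_states (T : Type) (f : state -> state -> T) X Y :
  entry (mx_of_states f) X Y = f X Y.
Proof. by rewrite /entry mxE !enum_rankK. Qed.

Lemma entry_inj (T : Type) (M N : 'M[T]_(#|{: state}|)) :
  (forall X Y, entry M X Y = entry N X Y) -> M = N.
Proof.
move=> eqMN; apply/matrixP => a b.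
by rewrite -[a]enum_valK -[b]enum_valK; apply: eqMN.
Qed.

Lemma entry_map (T U : Type) (f : T -> U) (M : 'M[T]_(#|{: state}|)) X Y :
  entry (map_mx f M) X Y = f (entry M X Y).
Proof. by rewrite /entry mxE. Qed.

Lemma entry_tr (T : Type) (M : 'M[T]_(#|{: state}|)) X Y :
  entry M^T X Y = entry M Y X.
Proof. by rewrite /entry mxE. Qed.

Lemma entry_mul (R : pzSemiRingType) (M N : 'M[R]_(#|{: state}|)) X Y :
  entry (M *m N) X Y = \sum_Z entry M X Z * entry N Z Y.
Proof.
by rewrite /entry mxE (reindex enum_rank) //; apply/onW_bij/enum_rank_bij.
Qed.

Lemma entry1 (R : pzSemiRingType) X Y :
  entry (1%:M : 'M[R]_(#|{: state}|)) X Y = (X == Y)%:R.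
Proof. by rewrite /entry mxE (can_eq enum_rankK). Qed.

End StateMatrices.

(** * The trace character, its orthogonality relations, and the MacWilliams transform of a
    monomial *)

Section AdditiveCharacter.

Variables (K : numClosedFieldType) (F : finFieldType) (p s : nat).
Hypotheses (p_prime : prime p) (cardF : #|F| = (p ^ s)%N).
Variable zeta : K.
Hypothesis zeta_prim : p.-primitive_root zeta.

Definition trace (a : F) : F := \sum_(i < s) a ^+ (p ^ i).

Definition chi (a : F) : K := zeta ^+ trace_rep p s a.

Let pcharF : p \in [pchar F] := card_finPcharP cardF p_prime.

Lemma traceD a b : trace (a + b) = trace a + trace b.
Proof.
rewrite -big_split /=; apply: eq_bigr => i _.
by apply: exprDn_pchar; rewrite (eq_pnat _ (pcharf_eq pcharF)) pnatX pnat_id.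
Qed.

Lemma natr_eq_mod (m l : nat) : (m%:R == l%:R :> F) = (m == l %[mod p]).
Proof.
wlog le_lm : m l / (l <= m)%N.
  by move=> W; case: (leqP l m) => [/W //|/ltnW /W E]; rewrite eq_sym E eq_sym.
by rewrite -subr_eq0 -natrB // -(dvdn_pcharf pcharF) -eqn_mod_dvd.
Qed.

(** The p multiples of 1 are already roots of ['X^p - 'X], so another fixed point would give p + 1
    roots. *)
Lemma frobenius_fixed (a : F) : a ^+ p = a -> exists m : 'I_p, m%:R = a.
Proof.
move=> fix_a; have p_gt1 := prime_gt1 p_prime.
have [/existsP[m /eqP am]|] := boolP [exists m : 'I_p, m%:R == a].
  by exists m.
move=> /existsPn nex.
pose rs := a :: [seq (val m)%:R | m <- enum 'I_p].
have q0 : 'X^p - 'X != 0 :> {poly F}.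
  by rewrite -size_poly_eq0 size_polyDl ?size_polyN size_polyXn ?size_polyX.
have urs : uniq rs.
  rewrite /= map_inj_uniq ?enum_uniq ?andbT.
    by apply/mapP => -[m _ am]; have := nex m; rewrite am eqxx.
  move=> x y /eqP; rewrite natr_eq_mod !modn_small ?ltn_ord //.
  by move=> /eqP /val_inj.
case/eqP: q0.
apply: (roots_geq_poly_eq0 (rs := rs)) => //; last first.
  by rewrite /= size_map size_enum_ord size_polyDl ?size_polyN size_polyXn
             ?size_polyX.
apply/allP => x; rewrite inE rootE !hornerE subr_eq0 => /orP[/eqP ->|].
  by rewrite fix_a.
case/mapP => m _ ->.
by rewrite -(pFrobenius_autE pcharF) pFrobenius_aut_nat.
Qed.

(** Frobenius permutes the conjugates of a cyclically; the cycle closes because a^q = a. *)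
Lemma trace_fixed a : trace a ^+ p = trace a.
Proof.
rewrite -(pFrobenius_autE pcharF) /trace rmorph_sum /=.
have s_gt0 : (0 < s)%N.
  by have := finNzRing_gt1 F; rewrite cardF; case: (s).
case: s s_gt0 cardF => // t _ cF.
rewrite big_ord_recr /= [RHS]big_ord_recl addrC; congr (_ + _).
  by rewrite pFrobenius_autE -exprM -expnSr -cF expf_card expn0 expr1.
by apply: eq_bigr => i _; rewrite pFrobenius_autE -exprM -expnSr.
Qed.

(** The trace lies in the prime field, so the search in [trace_rep] succeeds and its default 0 is
    never returned. *)
Lemma trace_repE a : (trace_rep p s a)%:R = trace a.
Proof.
rewrite /trace_rep; case: pickP => [m /eqP //|no].
have [m am] := frobenius_fixed (trace_fixed a).
by have := no m; rewrite am /trace eqxx.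
Qed.

Lemma chiD a b : chi (a + b) = chi a * chi b.
Proof.
rewrite /chi -exprD; apply/eqP; rewrite (eq_prim_root_expr zeta_prim).
by rewrite -natr_eq_mod natrD !trace_repE traceD.
Qed.

Lemma chi_neq0 a : chi a != 0.
Proof.
rewrite expf_neq0 //; apply: contra_eq_neq (prim_expr_order zeta_prim) => ->.
by rewrite expr0n gtn_eqF ?prime_gt0 // eq_sym oner_neq0.
Qed.

Lemma chi0 : chi 0 = 1.
Proof. by apply: (mulfI (chi_neq0 0)); rewrite mulr1 -chiD addr0. Qed.

Lemma chi_sum (I : finType) (f : I -> F) :
  chi (\sum_i f i) = \prod_i chi (f i).
Proof. by apply: (big_morph chi chiD chi0). Qed.

(* The trace is a polynomial of degree p^(s-1) < q, so it is not identically
   zero on F. *)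
Lemma chi_nontrivial : exists a, chi a != 1.
Proof.
have [t st] : exists t, s = t.+1.
  by have := finNzRing_gt1 F; rewrite cardF; case: (s) => // t _; exists t.
pose T : {poly F} := \sum_(i < s) 'X^(p ^ i).
have TE a : T.[a] = trace a.
  by rewrite horner_sum; apply: eq_bigr => i _; rewrite hornerXn.
have szT : (size T <= (p ^ t).+1)%N.
  apply: (leq_trans (size_sum _ _ _)); apply/bigmax_leqP => i _.
  rewrite size_polyXn ltnS leq_pexp2l ?prime_gt0 //.
  by rewrite -ltnS -st.
have T0 : T != 0.
  apply/eqP => /(congr1 (fun q : {poly F} => q`_(p ^ t))).
  rewrite coef0 coef_sum.
  have lt_ts : (t < s)%N by rewrite st.
  rewrite (bigD1 (Ordinal lt_ts)) //= coefXn eqxx big1 ?addr0.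
    by move/eqP; rewrite oner_eq0.
  move=> i /eqP ne_it; rewrite coefXn; case: eqP => // /expnI E.
  by case: ne_it; apply: val_inj; rewrite /= E // prime_gt1.
have [a ta] : exists a, trace a != 0.
  apply/existsP; apply: contraNT T0 => /existsPn tr0; apply/eqP.
  apply: (roots_geq_poly_eq0 (rs := enum F)); rewrite ?enum_uniq //.
    by apply/allP => a _; rewrite rootE TE -[_ == _]negbK tr0.
  rewrite -cardE cardF (leq_trans szT) // st.
  by rewrite ltn_exp2l ?prime_gt1.
exists a; apply: contra ta; rewrite -(expr0 zeta) /chi.
rewrite (eq_prim_root_expr zeta_prim) -natr_eq_mod trace_repE.
by rewrite mulr0n.
Qed.

Lemma betaE d (X Y : 'rV[F]_d) : beta X Y = (X *m Y^T) 0 0.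
Proof. by rewrite mxE; apply: eq_bigr => j _; rewrite mxE. Qed.

Lemma betaDl d (X X' Y : 'rV[F]_d) : beta (X + X') Y = beta X Y + beta X' Y.
Proof. by rewrite !betaE mulmxDl mxE. Qed.

Lemma betaDr d (X Y Y' : 'rV[F]_d) : beta X (Y + Y') = beta X Y + beta X Y'.
Proof. by rewrite !betaE linearD mulmxDr mxE. Qed.

Lemma betaNr d (X Y : 'rV[F]_d) : beta X (- Y) = - beta X Y.
Proof. by rewrite !betaE linearN mulmxN mxE. Qed.

Lemma betaC d (X Y : 'rV[F]_d) : beta X Y = beta Y X.
Proof. by apply: eq_bigr => j _; rewrite mulrC. Qed.

Lemma beta_mull d e (X : 'rV[F]_d) (M : 'M_(d, e)) Y :
  beta (X *m M) Y = beta X (Y *m M^T).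
Proof. by rewrite !betaE trmx_mul trmxK mulmxA. Qed.

(** Orthogonality of characters: for Y nonzero, a translation of the summation variable multiplies
    the sum by a value of [chi] other than 1. *)
Lemma sum_chi_beta d (Y : 'rV[F]_d) :
  \sum_(X : 'rV[F]_d) chi (beta X Y) = (Y == 0)%:R * #|F|%:R ^+ d.
Proof.
case: eqP => [->|/eqP /rV0Pn [j Yj]].
  rewrite mul1r (eq_bigr (fun=> 1)) => [|X _].
    by rewrite sumr_const card_mx mul1n natrX.
  by rewrite betaE trmx0 mulmx0 mxE chi0.
rewrite mul0r; have [a chia] := chi_nontrivial.
(* The translation vector is chosen so that its pairing with Y is exactly a. *)
pose X0 : 'rV[F]_d := (a / Y 0 j) *: delta_mx 0 j.
have bX0 : beta X0 Y = a.
  rewrite /beta (bigD1 j) //= big1 ?addr0 => [|i ne_ij].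
    by rewrite !mxE !eqxx mulr1 mulfVK.
  by rewrite !mxE (negbTE ne_ij) mulr0 mul0r.
set S := \sum_X _; have : chi a * S = S.
  rewrite {2}/S (reindex_inj (addIr X0)) /= mulr_sumr; apply: eq_bigr => X _.
  by rewrite betaDl bX0 chiD mulrC.
move/eqP; rewrite -subr_eq0 -[X in _ - X]mul1r -mulrBl mulf_eq0 subr_eq0.
by rewrite (negbTE chia) => /eqP.
Qed.

(** MacWilliams identity in one coordinate. For v nonzero the full character sum vanishes, so the
    nonzero a contribute -1 in total. *)
Lemma sum_chi_wt (v : F) :
  \sum_(a : F) (chi (v * a))%:P * 'X^(a != 0) =
  if v == 0 then 1 + (#|F|%:R - 1) *: 'X else 1 - 'X :> {poly K}.
Proof.
rewrite (bigD1 0) //= mulr0 chi0 eqxx mulr1; case: ifP => [/eqP v0|v0].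
  rewrite (eq_bigr (fun=> 'X)) => [|a a0]; last first.
    by rewrite v0 mul0r chi0 mul1r a0.
  congr (_ + _); rewrite sumr_const scalerBl scale1r scaler_nat.
  have -> : #|[pred i : F | i != 0]| = #|F|.-1 by rewrite cardC1.
  have : (0 < #|F|)%N by apply/card_gt0P; exists 0.
  by case: #|F| => // m _; rewrite mulrSr addrK.
rewrite (eq_bigr (fun a => chi (v * a) *: 'X)) => [|a a0]; last first.
  by rewrite a0 mul_polyC.
congr (_ + _); rewrite -scaler_suml -scaleN1r; congr (_ *: _).
have := sum_chi_beta (const_mx v : 'rV[F]_1).
have -> : (const_mx v == 0 :> 'rV[F]_1) = false.
  by apply/eqP => /rowP /(_ 0); rewrite !mxE => /eqP; rewrite v0.
rewrite mul0r (reindex (fun a : F => (const_mx a : 'rV[F]_1))) /=; last first.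
  exists (fun X : 'rV[F]_1 => X 0 0) => X _; first by rewrite mxE.
  by apply/rowP => j; rewrite mxE ord1.
rewrite (bigD1 0) //= => E; apply/eqP; rewrite -addr_eq0 addrC.
apply/eqP; apply: etrans E; congr (_ + _).
  by rewrite /beta big_ord1 !mxE mul0r chi0.
by apply: eq_bigr => a _; rewrite /beta big_ord1 !mxE mulrC.
Qed.

Lemma MacWilliamsD n (f g : {poly K}) :
  MacWilliams F n (f + g) = MacWilliams F n f + MacWilliams F n g.
Proof.
by rewrite -big_split; apply: eq_bigr => i _; rewrite coefD scalerDl.
Qed.

Lemma MacWilliamsZ n c (f : {poly K}) :
  MacWilliams F n (c *: f) = c *: MacWilliams F n f.
Proof.
by rewrite scaler_sumr; apply: eq_bigr => i _; rewrite coefZ scalerA.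
Qed.

Lemma MacWilliams_sum n (I : finType) (P : pred I) (f : I -> {poly K}) :
  MacWilliams F n (\sum_(i | P i) f i) = \sum_(i | P i) MacWilliams F n (f i).
Proof.
apply: (big_morph _ (@MacWilliamsD n)).
by rewrite -[in LHS](scale0r 0) MacWilliamsZ scale0r.
Qed.

Lemma wt_max n (v : 'rV[F]_n) : (wt v <= n)%N.
Proof. by rewrite -[n in leqRHS]card_ord max_card. Qed.

Lemma wtE n (v : 'rV[F]_n) : wt v = (\sum_j (v 0%R j != 0%R))%N.
Proof. by rewrite /wt -sum1dep_card big_mkcond. Qed.

(** The character sum is a product over coordinates of the sums in [sum_chi_wt]; v has [wt v]
    nonzero coordinates and n - [wt v] zero ones. *)
Lemma MacWilliams_wt n (v : 'rV[F]_n) :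
  MacWilliams F n ('X^(wt v)) =
  \sum_(x : 'rV[F]_n) (chi (beta v x))%:P * 'X^(wt x) :> {poly K}.
Proof.
have lt_wt : (wt v < n.+1)%N by rewrite ltnS wt_max.
rewrite /MacWilliams (bigD1 (Ordinal lt_wt)) //= coefXn eqxx scale1r.
rewrite big1 ?addr0 => [|i ne_i]; last first.
  by rewrite coefXn -[(i : nat) == _]/(i == Ordinal lt_wt) (negbTE ne_i) scale0r.
pose f (j : 'I_n) (a : F) : {poly K} := (chi (v 0 j * a))%:P * 'X^(a != 0).
transitivity (\prod_j \sum_a f j a).
  rewrite (eq_bigr (fun j => if v 0 j == 0 then 1 + (#|F|%:R - 1) *: 'X
                             else 1 - 'X)) => [|j _]; last exact: sum_chi_wt.
  rewrite (bigID (fun j => v 0 j != 0)) /=.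
  rewrite (eq_bigr (fun=> 1 - 'X)) => [|j /negbTE -> //].
  rewrite [X in _ = _ * X](eq_bigr (fun=> 1 + (#|F|%:R - 1) *: 'X)); last first.
    by move=> j; rewrite negbK => ->.
  rewrite !prodr_const; congr (_ ^+ _ * _ ^+ _); first by rewrite /wt cardsE.
  transitivity (#|'I_n| - wt v)%N; first by rewrite card_ord.
  by rewrite -(cardC (fun j => v 0 j != 0)) /wt cardsE addKn.
(* Expanding the product of sums gives one term per choice of all coordinates, that is, per vector
   x. *)
rewrite bigA_distr_bigA /= (reindex (fun x : 'rV[F]_n => [ffun j => x 0 j])).
  apply: eq_bigr => x _; rewrite big_split /=; congr (_ * _).
    rewrite /beta chi_sum rmorph_prod; apply: eq_bigr => j _.
    by rewrite ffunE.
  by rewrite wtE -prodrXr /=; apply: eq_bigr => j _; rewrite ffunE.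
exists (fun g : {ffun 'I_n -> F} => \row_j g j) => [x|g] _.
  by apply/rowP => j; rewrite mxE ffunE.
by apply/ffunP => j; rewrite ffunE mxE.
Qed.

(** * Fourier and MacWilliams transforms of the adjacency matrix when A = 0 *)

Section FourierTransform.

Variables (delta k n : nat).
Variables (B : 'M[F]_(k, delta)) (Cc : 'M[F]_(delta, n)) (D : 'M[F]_(k, n)).
Local Notation state := 'rV[F]_delta.
Local Notation H := (Hmx F p s zeta delta).

Let q_unit : #|F|%:R != 0 :> K.
Proof. by rewrite pnatr_eq0 cardF expn_eq0 -leqn0 leqNgt prime_gt0. Qed.

(** The candidate inverse of H: the inverse character values with the same normalisation. *)
Let Hinv : 'M[K]_(#|{: state}|) :=
  sqrtC (#|F|%:R) ^- delta *: mx_of_states (fun X Y => chi (- beta X Y)).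

Lemma sqrtCV_sqr :
  sqrtC (#|F|%:R : K) ^- delta * sqrtC (#|F|%:R) ^- delta = #|F|%:R ^- delta.
Proof. by rewrite -invfM -exprMn -expr2 sqrtCK. Qed.

Lemma entry_H X Y : entry H X Y = sqrtC (#|F|%:R) ^- delta * chi (beta X Y).
Proof. by rewrite /entry mxE -/(entry _ X Y) entry_mx_of_states. Qed.

Lemma entry_Hinv X Y :
  entry Hinv X Y = sqrtC (#|F|%:R) ^- delta * chi (- beta X Y).
Proof. by rewrite /entry mxE -/(entry _ X Y) entry_mx_of_states. Qed.

Lemma Hmx_mulV : H *m Hinv = 1%:M.
Proof.
apply: entry_inj => X Y; rewrite entry_mul entry1.
under eq_bigr => Z _ do
  rewrite entry_H entry_Hinv mulrACA sqrtCV_sqr -chiD betaC -betaNr -betaDr.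
rewrite -mulr_sumr sum_chi_beta subr_eq0 mulrCA mulVf ?mulr1 //.
by rewrite expf_neq0.
Qed.

Lemma invmx_Hmx : invmx H = Hinv.
Proof.
have [unitH _] := mulmx1_unit Hmx_mulV.
by rewrite -[Hinv](mulKmx unitH) Hmx_mulV mulmx1.
Qed.

Hypothesis D_inj : injective (mulmx^~ D : 'rV_k -> 'rV_n).

(** Once each monomial is transformed, the sums over V and u separate into two orthogonality
    relations, one per equation on x. They yield q^delta, absorbed by the normalisation of H and its
    inverse, and q^k. *)
Lemma MacWilliams_entry X Y :
  MacWilliams F n (entry (map_mx polyC H *m (adjacency K 0 B Cc D)^T
                          *m map_mx polyC (invmx H)) X Y) =
  #|F|%:R ^+ k *:
    we K [set x : 'rV[F]_n | (x *m D^T == - (X *m B^T)) && (x *m Cc^T == Y)].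
Proof.
have adjE V U : entry (adjacency K 0 B Cc D) V U =
    \sum_(u | U == u *m B) 'X^(wt (V *m Cc + u *m D)).
  (* Distinct u give distinct outputs by [D_inj], so the enumerator of the image set is a sum over
     u. *)
  rewrite entry_mx_of_states /we big_imset /=; last first.
    by move=> u u' _ _ /addrI /D_inj.
  by apply: eq_bigl => u; rewrite !inE mulmx0 add0r.
pose c : K := #|F|%:R ^- delta.
have -> : entry (map_mx polyC H *m (adjacency K 0 B Cc D)^T
                 *m map_mx polyC (invmx H)) X Y =
    \sum_V \sum_u (c * chi (beta u (X *m B^T) - beta V Y))
                     *: 'X^(wt (V *m Cc + u *m D)).
  rewrite entry_mul; apply: eq_bigr => V _.
  rewrite invmx_Hmx entry_map entry_mul mulr_suml.
  under eq_bigr => U _ do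
    rewrite entry_map entry_tr adjE mulrAC mulr_sumr -polyCM
            entry_H entry_Hinv mulrACA sqrtCV_sqr -chiD.
  (* For each u only the next state U = uB survives. *)
  rewrite (exchange_big_dep xpredT) //=; apply: eq_bigr => u _.
  by rewrite big_pred1_eq mul_polyC betaC beta_mull [beta V Y]betaC.
rewrite MacWilliams_sum.
under eq_bigr => V _ do rewrite MacWilliams_sum.
under eq_bigr => V _ do under eq_bigr => u _ do
  rewrite MacWilliamsZ MacWilliams_wt scaler_sumr.
(* Moving matrices across [beta] gathers the argument of [chi] into one term linear in V and one
   linear in u. *)
have termE V u x : (c * chi (beta u (X *m B^T) - beta V Y))
      *: ((chi (beta (V *m Cc + u *m D) x))%:P * 'X^(wt x)) =
    (c * chi (beta V (x *m Cc^T - Y)) * chi (beta u (x *m D^T + X *m B^T)))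
      *: 'X^(wt x).
  rewrite mul_polyC scalerA -!mulrA -!chiD; congr ((_ * chi _) *: _).
  by rewrite betaDl !beta_mull !betaDr betaNr; ring.
under eq_bigr => V _ do under eq_bigr => u _ do under eq_bigr => x _ do
  rewrite termE.
under eq_bigr => V _ do rewrite exchange_big /=.
rewrite exchange_big /= /we scaler_sumr [RHS]big_mkcond /=.
apply: eq_bigr => x _; rewrite inE.
under eq_bigr => V _ do rewrite -scaler_suml -mulr_sumr sum_chi_beta.
rewrite -scaler_suml -mulr_suml -mulr_sumr sum_chi_beta subr_eq0 addr_eq0.
rewrite [c * _]mulrCA mulVf ?expf_neq0 // mulr1 andbC.
by do 2!case: eqP => _; rewrite ?mul0r ?mul1r ?mulr0 ?scale0r.
Qed.

End FourierTransform.

End AdditiveCharacter.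

(** * Top coefficients of products and determinants *)

Section TopCoefficients.

Variable R : comNzRingType.

Lemma coefM_top (f g : {poly R}) a b :
  (size f <= a.+1)%N -> (size g <= b.+1)%N -> (f * g)`_(a + b) = f`_a * g`_b.
Proof.
move=> szf szg; rewrite coefM.
have lt_a : (a < (a + b).+1)%N by rewrite ltnS leq_addr.
rewrite (bigD1 (Ordinal lt_a)) //= addKn big1 ?addr0 // => i ne_ia.
have [lt_ia|lt_ai|eq_ia] := ltngtP i a.
- by rewrite [X in _ * X]nth_default ?mulr0 //; apply: leq_trans szg _; lia.
- by rewrite [X in X * _]nth_default ?mul0r // (leq_trans szf).
- by case/eqP: ne_ia; apply: val_inj.
Qed.

Lemma coef_prod_top (I : Type) (r : seq I) (f : I -> {poly R}) (d : I -> nat) :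
  (forall i, (size (f i) <= (d i).+1)%N) ->
  (size (\prod_(i <- r) f i)%R <= (\sum_(i <- r) d i).+1)%N /\
  (\prod_(i <- r) f i)`_(\sum_(i <- r) d i)%N = \prod_(i <- r) (f i)`_(d i).
Proof.
move=> szf; elim: r => [|i r [IHs IHc]].
  by rewrite !big_nil size_poly1 coef1.
rewrite !big_cons coefM_top // IHc; split=> //.
apply: leq_trans (size_polyMleq _ _) _.
have := leq_add (szf i) IHs; rewrite addSn addnS.
by case: (_ + _)%N.
Qed.

(** Every Leibniz term has one factor per row, so its coefficient at the sum of the row bounds is
    the product of the coefficients at those bounds. *)
Lemma coef_det_top m (M : 'M[{poly R}]_m) (d : 'I_m -> nat) :
  (forall i j, (size (M i j) <= (d i).+1)%N) ->
  (\det M)`_(\sum_i d i)%N = \det (\matrix_(i, j) (M i j)`_(d i)).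
Proof.
move=> szM; rewrite coef_sum; apply: eq_bigr => sg _.
have [_ prodE] := coef_prod_top (index_enum _) (fun i => szM i (fun_of_perm sg i)).
under [in RHS]eq_bigr => i _ do rewrite mxE.
rewrite -prodE; case: (odd_perm sg); rewrite ?expr0 ?expr1 ?mul1r //.
by rewrite !mulN1r coefN.
Qed.

Lemma coefM_size2 (f g : {poly R}) m : (size g <= 2)%N ->
  (f * g)`_m.+1 = f`_m.+1 * g`_0 + f`_m * g`_1.
Proof.
move=> szg; rewrite coefMr !big_ord_recl big1 ?addr0 ?subn0 ?subn1 //= => i _.
by rewrite [X in _ * X]nth_default ?mulr0 // (leq_trans szg).
Qed.

End TopCoefficients.

Lemma row_free_leq (F : fieldType) m n (A : 'M[F]_(m, n)) :
  row_free A -> (m <= n)%N.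
Proof. by rewrite -row_leq_rank => /leq_trans -> //; apply: rank_leq_col. Qed.

(** * Row-reduced encoders and the predictable degree property *)

Section RowReduced.

Variables (F : finFieldType) (n : nat).

(** The high-order coefficient matrix; an encoder is row-reduced when it has full row rank. *)
Definition lead_rows k (G : 'M[{poly F}]_(k, n)) : 'M[F]_(k, n) :=
  \matrix_(i, j) (G i j)`_(row_degree G i).

Lemma size_row_degree k (G : 'M[{poly F}]_(k, n)) i j :
  (size (G i j) <= (row_degree G i).+1)%N.
Proof.
have: ((size (G i j)).-1 <= row_degree G i)%N.
  exact: (@leq_bigmax _ (fun j => (size (G i j)).-1) j).
by case: (size _).
Qed.

(** The sum of the row degrees bounds the degree of each k-minor, and the coefficient there is the
    matching minor of [lead_rows G]. Minimality says that the bound is attained. *)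
Lemma lead_rows_free k (G : 'M[{poly F}]_(k, n)) :
    basic G -> (\sum_(i < k) row_degree G i)%N = minor_degree G ->
  exists E, lead_rows G *m E = 1%:M.
Proof.
case=> Gt GGt degG.
(* A zero minor also counts as degree 0, so the minor argument needs a positive sum. With sum 0, G
   is constant and basicness at z = 0 suffices. *)
have [sum0|sum_gt0] := posnP (\sum_(i < k) row_degree G i)%N.
  exists (map_mx (horner_eval 0) Gt).
  have -> : lead_rows G = map_mx (horner_eval 0) G.
    apply/matrixP => i j; rewrite !mxE /horner_eval horner_coef0.
    by move/eqP: sum0; rewrite sum_nat_eq0 => /forallP /(_ i) /eqP ->.
  by rewrite -map_mxM GGt map_mx1.
have card_gt0 : (0 < #|@increasing n k|)%N.
  rewrite lt0n; apply: contraTneq sum_gt0 => c0.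
  by rewrite degG /minor_degree big_pred0 // => f; exact: (card0_eq c0 f).
have [f _ degf] := eq_bigmax_cond
  (fun f : {ffun 'I_k -> 'I_n} => (size (\det (colsub f G))).-1) card_gt0.
have detf : \det (colsub f (lead_rows G)) = lead_coef (\det (colsub f G)).
  rewrite /lead_coef -degf -/(minor_degree G) -degG coef_det_top.
    by congr (\det _); apply/matrixP => i j; rewrite !mxE.
  by move=> i j; rewrite mxE size_row_degree.
have unitf : colsub f (lead_rows G) \in unitmx.
  rewrite unitmxE detf unitfE lead_coef_eq0; apply: contraTneq sum_gt0 => det0.
  by rewrite degG /minor_degree degf det0 size_poly0.
(* Select the columns of the nonzero minor, then invert. *)
exists (colsub f 1%:M *m invmx (colsub f (lead_rows G))).
by rewrite mulmxA mulmx_colsub mulmx1 mulmxV.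
Qed.

(** Top-degree terms of uG could cancel only through a linear relation between the rows of
    [lead_rows G]. The proof lowers the bound on u one degree at a time down to N. *)
Lemma predictable_degree k (G : 'M[{poly F}]_(k, n)) (E : 'M_(n, k))
    (u : 'rV[{poly F}]_k) (N : nat) :
    lead_rows G *m E = 1%:M ->
    (forall j m, (N <= m)%N -> ((u *m G) 0 j)`_m = 0) ->
  forall i a, (N <= row_degree G i + a)%N -> (u 0 i)`_a = 0.
Proof.
move=> LE hi.
pose vanish M := forall i a, (M <= row_degree G i + a)%N -> (u 0 i)`_a = 0.
have step M : (N <= M)%N -> vanish M.+1 -> vanish M.
  move=> leNM vM.
  (* The coefficients of u that can still reach degree M; by [vM] they alone make up the degree-M
     coefficient of uG. *)
  pose c : 'rV_k := \row_i
    (if (row_degree G i <= M)%N then (u 0 i)`_(M - row_degree G i) else 0).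
  have cL : c *m lead_rows G = 0.
    apply/rowP => j; rewrite [RHS]mxE -[RHS](hi j M leNM) !mxE coef_sum.
    apply: eq_bigr => i _; rewrite !mxE coefM; case: leqP => le_diM.
      have ltM : (M - row_degree G i < M.+1)%N by rewrite ltnS leq_subr.
      rewrite (bigD1 (Ordinal ltM)) //= subKn // big1 ?addr0 // => a ne_a.
      have [lt_a|gt_a|eq_a] := ltngtP a (M - row_degree G i)%N.
      - rewrite [X in _ * X]nth_default ?mulr0 //.
        by apply: leq_trans (size_row_degree G i j) _; lia.
      - by rewrite vM ?mul0r //; lia.
      - by case/eqP: ne_a; apply: val_inj.
    rewrite mul0r big1 // => a _; rewrite vM ?mul0r //.
    by rewrite (leq_trans le_diM) // leq_addr.
  have c0 : c = 0 by rewrite -[c]mulmx1 -LE mulmxA cL mul0mx.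
  move=> i a; rewrite leq_eqVlt => /orP[/eqP eqM|]; last exact: vM.
  move/rowP: c0 => /(_ i); rewrite !mxE eqM leq_addr.
  by rewrite addKn.
(* The descent starts beyond the size of every entry of u. *)
have top : vanish (N + \sum_i (size (u 0%R i) + row_degree G i))%N.
  move=> i a le_a; rewrite nth_default //.
  rewrite -(leq_add2l (row_degree G i)) (leq_trans _ le_a) //.
  by rewrite (bigD1 i) //= addnC [X in (X <= _)%N]addnC; lia.
elim: (\sum_i _)%N top => [|d IHd]; first by rewrite addn0.
by rewrite addnS => /step -/(_ (leq_addr _ _)) /IHd.
Qed.

End RowReduced.

(** * Encoders of a code and of its dual, with exactness between them *)

Section Encoders.

Variables (F : finFieldType) (n : nat).
Implicit Type C : 'rV[{poly F}]_n -> Prop.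

Lemma rows_factor (R : pzSemiRingType) m k (M : 'M[R]_(m, n)) (G : 'M_(k, n)) :
  (forall i, exists u : 'rV_k, row i M = u *m G) -> exists U, M = U *m G.
Proof.
case/fin_all_exists => u Mu; exists (\matrix_i u i).
by apply/row_matrixP => i; rewrite Mu row_mul rowK.
Qed.

Lemma encoder_row C k (G : 'M_(k, n)) i : encoder C G -> C (row i G).
Proof. by case=> _ ->; exists (delta_mx 0 i); rewrite -rowE. Qed.

(** A right inverse cancels G from UVG = G, so U is unimodular; its determinant is a nonzero
    constant and only scales the minors. *)
Lemma minor_degree_encoder C k (G G' : 'M_(k, n)) :
  encoder C G -> encoder C G' -> minor_degree G = minor_degree G'.
Proof.
move=> encG encG'.
have [U GU] : exists U, G = U *m G'.
  by apply: rows_factor => i; apply/(proj2 encG')/(encoder_row i encG).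
have [V GV] : exists V, G' = V *m G.
  by apply: rows_factor => i; apply/(proj2 encG)/(encoder_row i encG').
have [[Gt GGt] _] := encG.
have UV : U *m V = 1%:M.
  by rewrite -[LHS]mulmx1 -GGt mulmxA -(mulmxA U) -GV -GU.
have [unitU _] := mulmx1_unit UV.
move: unitU; rewrite unitmxE poly_unitE => /andP[/eqP sz1 c_unit].
have detU : \det U = ((\det U)`_0)%:P by apply: size1_polyC; rewrite sz1.
apply: eq_bigr => f _.
have -> : colsub f G = U *m colsub f G' by rewrite mulmx_colsub -GU.
rewrite det_mulmx detU mul_polyC size_scale //.
by move: c_unit; rewrite unitfE.
Qed.

Section Dual.

Variables (C : 'rV[{poly F}]_n -> Prop) (k l : nat).
Variables (G : 'M[{poly F}]_(k, n)) (Gh : 'M[{poly F}]_(l, n)).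
Hypotheses (encG : encoder C G) (encGh : encoder (dual_code C) Gh).

Lemma dual_codeP (w : 'rV_n) : dual_code C w <-> w *m G^T = 0.
Proof.
split=> [dual_w|wG v].
  apply/rowP => i; rewrite !mxE -[RHS](dual_w _ (encoder_row i encG)).
  by apply: eq_bigr => j _; rewrite !mxE.
case/(proj2 encG) => u ->.
transitivity ((w *m (u *m G)^T) 0 0).
  by rewrite [RHS]mxE; apply: eq_bigr => j _; rewrite [in RHS]mxE.
by rewrite trmx_mul mulmxA wG mul0mx mxE.
Qed.

Lemma dual_encoderP (w : 'rV_n) :
  w *m G^T = 0 <-> exists u : 'rV_l, w = u *m Gh.
Proof. by rewrite -dual_codeP; apply: (proj2 encGh). Qed.

Lemma dual_encoder_mul0 : Gh *m G^T = 0.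
Proof.
apply/row_matrixP => i; rewrite row_mul row0.
by apply/dual_encoderP; exists (delta_mx 0 i); rewrite -rowE.
Qed.

(* Since G is basic, the projector complementary to its row space factors
   through Gh: this yields exactness at both ends, without ranks. *)
Lemma dual_encoder_split :
  exists Gt, exists2 Q, G *m Gt = 1%:M & (1%:M - Gt *m G)^T = Q *m Gh.
Proof.
have [[Gt GGt] _] := encG; exists Gt.
have [Q QE] : exists Q, (1%:M - Gt *m G)^T = Q *m Gh.
  apply: rows_factor => i; apply/dual_encoderP.
  by rewrite -row_mul -trmx_mul mulmxBr mulmx1 mulmxA GGt mul1mx subrr trmx0 row0.
by exists Q.
Qed.

(** In v = v Gt G + v (1 - Gt G) the second term is v Gh^T Q^T = 0. *)
Lemma bidual (v : 'rV_n) : v *m Gh^T = 0 -> exists u : 'rV_k, v = u *m G.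
Proof.
have [Gt [Q _ QE]] := dual_encoder_split => vGh; exists (v *m Gt).
apply/eqP; rewrite -subr_eq0 -mulmxA -{1}[v]mulmx1 -mulmxBr.
by rewrite -[X in v *m X]trmxK QE trmx_mul mulmxA vGh mul0mx.
Qed.

(** The splitting of [dual_encoder_split] evaluated at z = 0 gives exactness for the constant
    matrices. *)
Lemma ker_ccf_D (x : 'rV[F]_n) :
  x *m (ccf_D G)^T = 0 -> exists u : 'rV_l, x = u *m ccf_D Gh.
Proof.
have [Gt [Q _ QE]] := dual_encoder_split => xD.
exists (x *m map_mx (horner_eval 0) Q).
move: QE => /(congr1 (map_mx (horner_eval 0))); rewrite map_mxM => QE.
rewrite -mulmxA -[ccf_D Gh]/(map_mx (horner_eval 0) Gh) -QE.
rewrite -map_trmx map_mxB map_mx1 map_mxM linearB /= trmx1 trmx_mul.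
by rewrite mulmxBr mulmx1 mulmxA [X in X *m _]xD mul0mx subr0.
Qed.

End Dual.

End Encoders.

(** * Indexing the states of the controller form by row and register *)

Section ControllerForm.

Variables (F : finFieldType) (n k delta : nat) (G : 'M[{poly F}]_(k, n)).

Definition coef_mx m : 'M[F]_(k, n) := map_mx (fun f : {poly F} => f`_m) G.

Lemma coef_mx0 : coef_mx 0 = ccf_D G.
Proof. by apply/matrixP => i j; rewrite !mxE horner_coef0. Qed.

Lemma coef_row_degree i j m : (row_degree G i < m)%N -> (G i j)`_m = 0.
Proof.
by move=> lt_m; rewrite nth_default // (leq_trans (size_row_degree _ _ _)).
Qed.

(* State x is the register r x of the shift chain of row [i x]; its C-row is the
   coefficient of z^(r x + 1). *)
Record state_index (i : 'I_delta -> 'I_k) (r : 'I_delta -> nat) : Prop := {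
  reg_lt : forall x, (r x < row_degree G (i x))%N;
  reg_inj : forall x y, i x = i y -> r x = r y -> x = y;
  reg_surj : forall l t, (t < row_degree G l)%N -> exists2 x, i x = l & r x = t;
  ccf_AE : forall x y,
    ccf_A delta G x y = ((i x == i y) && ((r x).+1 == r y))%:R;
  ccf_BE : forall l y, ccf_B delta G l y = ((l == i y) && (r y == 0%N))%:R;
  ccf_CE : forall x j, ccf_C delta G x j = (G (i x) j)`_(r x).+1 }.

End ControllerForm.

Lemma state_index_exists (F : finFieldType) n k delta (G : 'M[{poly F}]_(k, n)) :
    (\sum_(i < k) row_degree G i)%N = delta ->
  exists (i : 'I_delta -> 'I_k) r, state_index G i r.
Proof.
move=> <-; exists (@tagnat.sig1 k (row_degree G)).
(* The row is the block containing x and the register is the offset inside that block. *)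
exists (fun x => tagnat.sig2 x); split.
- by move=> x; apply: ltn_ord.
- move=> x y eq1 /= eq2.
  apply: val_inj; rewrite /= [LHS]tagnat.rect [RHS]tagnat.rect.
  by rewrite eq2; congr addn; apply: eq_bigl => l; rewrite eq1.
- move=> l t lt_t; exists (tagnat.Rank l (Ordinal lt_t)).
    by rewrite tagnat.Rank1K.
  by rewrite tagnat.Rank2K.
- move=> x y; rewrite /ccf_A conform_mx_id mxE.
  move: (tagnat.sig2 x) (tagnat.sig2 y).
  case: (tagnat.sig1 x =P tagnat.sig1 y) => [e|_] a b; last by rewrite mxE.
  by case: _ / e b => b; rewrite conform_mx_id mxE.
- by move=> l y; rewrite /ccf_B conform_mx_id !mxE.
- by move=> x j; rewrite /ccf_C conform_mx_id !mxE.
Qed.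

(** * Products of the controller matrices, and their shape for row degrees at most 1 *)

Section StateIndex.

Variables (F : finFieldType) (n k delta : nat) (G : 'M[{poly F}]_(k, n)).
Variables (i : 'I_delta -> 'I_k) (r : 'I_delta -> nat).
Hypothesis idx : state_index G i r.

(** A moves to the next register of the chain; at its end both sides vanish, the right one being a
    coefficient above the row degree. *)
Lemma ccf_mulAC x j :
  (ccf_A delta G *m ccf_C delta G) x j = (G (i x) j)`_(r x).+2.
Proof.
rewrite mxE; under eq_bigr => y _ do rewrite (ccf_AE idx) (ccf_CE idx).
have [lt_r|ge_r] := ltnP (r x).+1 (row_degree G (i x)).
  have [y iy ry] := reg_surj idx lt_r.
  rewrite (bigD1 y) //= iy ry !eqxx mul1r big1 ?addr0 // => z ne_zy.
  case: andP => [[/eqP iz /eqP rz]|_]; last by rewrite mul0r.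
  by case/eqP: ne_zy; apply: (reg_inj idx); rewrite ?iy ?ry.
rewrite coef_row_degree // big1 // => y _.
case: andP => [[/eqP iy /eqP ry]|_]; last by rewrite mul0r.
by have := reg_lt idx y; rewrite -iy -ry ltnNge ge_r.
Qed.

(** B feeds register 0, whose C-row holds the coefficient of z; for a row of degree 0 both sides
    vanish. *)
Lemma ccf_mulBC : ccf_B delta G *m ccf_C delta G = coef_mx G 1.
Proof.
apply/matrixP => l j; rewrite !mxE.
under eq_bigr => y _ do rewrite (ccf_BE idx) (ccf_CE idx).
have [deg_gt0|deg0] := ltnP 0 (row_degree G l).
  have [y iy ry] := reg_surj idx deg_gt0.
  rewrite (bigD1 y) //= iy ry !eqxx mul1r big1 ?addr0 // => z ne_zy.
  case: andP => [[/eqP iz /eqP rz]|_]; last by rewrite mul0r.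
  by case/eqP: ne_zy; apply: (reg_inj idx); rewrite ?iy ?ry.
rewrite coef_row_degree // big1 // => y _.
case: andP => [[/eqP iy /eqP ry]|_]; last by rewrite mul0r.
by have := reg_lt idx y; rewrite -iy ltnNge (leq_trans deg0).
Qed.

Hypothesis deg_le1 : forall l, (row_degree G l <= 1)%N.

Lemma reg_eq0 x : r x = 0%N.
Proof.
by apply/eqP; rewrite -leqn0 -ltnS (leq_trans (reg_lt idx x)).
Qed.

Lemma ccf_A_deg1 : ccf_A delta G = 0.
Proof. by apply/matrixP => x y; rewrite (ccf_AE idx) !reg_eq0 andbF mxE. Qed.

(** Each chain has a single register, so the columns of B are distinct unit vectors. *)
Lemma ccf_B_deg1 : (ccf_B delta G)^T *m ccf_B delta G = 1%:M.
Proof.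
apply/matrixP => x y; rewrite !mxE (bigD1 (i x)) //= !mxE !(ccf_BE idx) !reg_eq0.
rewrite !eqxx /= !andbT mul1r big1 ?addr0 => [|l ne_l]; last first.
  by rewrite mxE (ccf_BE idx) (negbTE ne_l) mul0r.
congr (_%:R); congr nat_of_bool; apply/eqP/eqP => [eq_i|-> //].
by apply: (reg_inj idx); rewrite ?reg_eq0.
Qed.

End StateIndex.

(** * Duality between the two controller forms and invertibility of P *)

Section DualPair.

Variables (F : finFieldType) (n k l d e : nat).
Variables (C : 'rV[{poly F}]_n -> Prop).
Variables (G : 'M[{poly F}]_(k, n)) (Gh : 'M[{poly F}]_(l, n)).
Hypotheses (encG : encoder C G) (encGh : encoder (dual_code C) Gh).
Variables (i : 'I_d -> 'I_k) (r : 'I_d -> nat).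
Variables (ih : 'I_e -> 'I_l) (rh : 'I_e -> nat).
Hypotheses (idx : state_index G i r) (idxh : state_index Gh ih rh).
Hypothesis deg_le1 : forall m, (row_degree G m <= 1)%N.

Local Notation B := (ccf_B d G).
Local Notation Cc := (ccf_C d G).
Local Notation D := (ccf_D G).
Local Notation Ah := (ccf_A e Gh).
Local Notation Bh := (ccf_B e Gh).
Local Notation Ch := (ccf_C e Gh).
Local Notation Dh := (ccf_D Gh).

Let size_G a j : (size (G a j) <= 2)%N.
Proof. by apply: leq_trans (size_row_degree G a j) _; rewrite ltnS. Qed.

Let conv0 : Dh *m D^T = 0.
Proof.
have := congr1 (map_mx (horner_eval 0)) (dual_encoder_mul0 encG encGh).
by rewrite map_mxM map_mx0 -map_trmx.
Qed.

(** The coefficient of z^(m+1) in Gh G^T = 0, which has two terms because G has degree at most 1. *)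
Let convS m : coef_mx Gh m.+1 *m D^T = - (coef_mx Gh m *m (coef_mx G 1)^T).
Proof.
apply/matrixP => a b; apply/eqP; rewrite [X in _ == X]mxE -addr_eq0.
have /matrixP /(_ a b) := dual_encoder_mul0 encG encGh.
rewrite !mxE => /(congr1 (fun f : {poly F} => f`_m.+1)).
rewrite coef0 coef_sum => conv; apply/eqP; rewrite -[RHS]conv -big_split /=.
by apply: eq_bigr => j _; rewrite !mxE coefM_size2 // horner_coef0.
Qed.

Let convSE m a b : \sum_j (Gh a j)`_m.+1 * D b j =
  - \sum_j (Gh a j)`_m * (G b j)`_1.
Proof.
have /matrixP /(_ a b) := convS m; rewrite !mxE.
under eq_bigr => j _ do rewrite mxE [_^T _ _]mxE.
by under [in RHS]eq_bigr => j _ do rewrite 3!mxE.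
Qed.

Lemma dual_AC : Ah *m Ch *m D^T = - (Ch *m (coef_mx G 1)^T).
Proof.
apply/matrixP => x b; rewrite [RHS]mxE [in RHS]mxE [LHS]mxE.
under eq_bigr => j _ do rewrite (ccf_mulAC idxh) [_^T _ _]mxE.
under [in RHS]eq_bigr => j _ do rewrite (ccf_CE idxh) 2!mxE.
exact: convSE.
Qed.

Lemma dual_BC : Bh *m Ch *m D^T = - (Dh *m (coef_mx G 1)^T).
Proof. by rewrite (ccf_mulBC idxh) convS coef_mx0. Qed.

Lemma coef_mx1E : coef_mx G 1 = B *m Cc.
Proof. by rewrite (ccf_mulBC idx). Qed.

(** By the convolution identities [Ch *m D^T] factors on the right through (BC)^T = C^T B^T, and B^T
    B = 1 makes B B^T fix B^T. *)
Lemma dual_CBB : Ch *m D^T *m B *m B^T = Ch *m D^T.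
Proof.
have -> : Ch *m D^T =
    - ((\matrix_(x, j) (Gh (ih x) j)`_(rh x)) *m (coef_mx G 1)^T).
  apply/matrixP => x b; rewrite [RHS]mxE [in RHS]mxE [LHS]mxE.
  under eq_bigr => j _ do rewrite (ccf_CE idxh) [_^T _ _]mxE.
  under [in RHS]eq_bigr => j _ do rewrite 3!mxE.
  exact: convSE.
rewrite !mulNmx coef_mx1E trmx_mul -!mulmxA.
by rewrite [B^T *m (B *m _)]mulmxA (ccf_B_deg1 idx deg_le1) mul1mx.
Qed.

Lemma dual_state_inj Eh (X : 'rV_e) : lead_rows Gh *m Eh = 1%:M ->
  X *m Ch *m D^T = 0 -> X = 0.
Proof.
move=> leadh XCD.
(* Any N exceeding all registers would do; z^N clears the negative powers of the Laurent vector, and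
   [phi] is the result. *)
pose N := (\sum_y (rh y).+1)%N.
pose phi : 'rV[{poly F}]_l :=
  \sum_x (X 0 x *: 'X^(N.-1 - rh x)) *: delta_mx 0 (ih x).
have rh_lt x : (rh x < N)%N.
  by rewrite /N (bigD1 x) //= leq_addr.
have phiG j : (phi *m Gh) 0 j =
    \sum_x X 0 x *: ('X^(N.-1 - rh x) * Gh (ih x) j).
  rewrite mulmx_suml summxE; apply: eq_bigr => x _.
  by rewrite -scalemxAl -rowE !mxE scalerAl.
(* Dropping the first N coefficients undoes the shift and keeps the polynomial part; its constant
   term is X Ch. *)
pose w := map_mx (drop_poly N) (phi *m Gh).
have w_dual : w *m G^T = 0.
  apply/rowP => b; rewrite !mxE; apply/polyP => -[|m]; rewrite coef0 coef_sum.
    move/rowP: XCD => /(_ b); rewrite !mxE => XCD; rewrite -[RHS]XCD.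
    apply: eq_bigr => j _; rewrite coefM big_ord1 subn0 [w _ _]mxE coef_drop_poly.
    rewrite phiG coef_sum add0n [_^T _ _]mxE [D^T _ _]mxE [D _ _]mxE horner_coef0.
    congr (_ * _); rewrite mxE; apply: eq_bigr => x _.
    rewrite coefZ coefXnM (ccf_CE idxh); congr (_ * _).
    case: ltnP => [?|_]; last by congr (_`_ _); have := rh_lt x; lia.
    by have := rh_lt x; lia.
  (* Above degree 0 the truncation is invisible: since G has degree at most 1, only coefficients
     kept in w occur. *)
  have : ((phi *m Gh *m G^T) 0 b)`_(m + N).+1 = 0.
    by rewrite -mulmxA (dual_encoder_mul0 encG encGh) mulmx0 mxE coef0.
  rewrite mxE coef_sum => sum0; rewrite -[RHS]sum0; apply: eq_bigr => j _.
  rewrite [_^T _ _]mxE !coefM_size2 // [w _ _]mxE !coef_drop_poly.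
  by rewrite addSn.
have [u wu] : exists u : 'rV_l, w = u *m Gh.
  exact/(dual_encoderP encG encGh).
have red m j : (N <= m)%N -> (((phi - 'X^N *: u) *m Gh) 0 j)`_m = 0.
  move=> le_Nm; rewrite mulmxBl -scalemxAl -wu !mxE coefB coefXnM coef_drop_poly.
  by rewrite ltnNge le_Nm /= subnK // subrr.
apply/rowP => x; rewrite [RHS]mxE.
(* The exponent carrying X_x in [phi] is forced to vanish because [rh x] is below the row degree. It
   is less than N, so z^N u does not interfere, and other states of the same row use other
   exponents. *)
have le_N : (N <= row_degree Gh (ih x) + (N.-1 - rh x))%N.
  by have := reg_lt idxh x; have := rh_lt x; lia.
have := predictable_degree leadh (fun j m => red m j) le_N.
rewrite !mxE coefB coefXnM ifT ?subr0; last by have := rh_lt x; lia.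
rewrite summxE coef_sum (bigD1 x) //= !mxE !eqxx mulr1 coefZ coefXn eqxx mulr1.
rewrite big1 ?addr0 // => y ne_yx; rewrite !mxE eqxx /=.
case: eqP => [eq_i|_]; last by rewrite mulr0 coef0.
rewrite mulr1 coefZ coefXn; case: eqP => [eq_r|_]; last by rewrite mulr0.
case/eqP: ne_yx; apply: (reg_inj idxh) => //.
by have := rh_lt x; have := rh_lt y; lia.
Qed.

(** The constant word Y B^T D is orthogonal to Gh, hence equals uG. Predictable degrees make u
    vanish on the rows of positive degree, while u(0) = Y B^T lives on exactly those rows. *)
Lemma dual_state_surj E (Y : 'rV_d) : lead_rows G *m E = 1%:M ->
  Y *m B^T *m D *m Ch^T = 0 -> Y = 0.
Proof.
move=> lead YBD.
pose v := Y *m B^T *m D.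
(* Degree 0 comes from Dh D^T = 0; every higher coefficient of Gh is a row of Ch or lies above the
   row degree. *)
have vE m a : \sum_j v 0 j * (Gh a j)`_m = 0.
  case: m => [|t].
    have : v *m Dh^T = 0.
      by rewrite /v -mulmxA -[D *m _]trmxK trmx_mul trmxK conv0 trmx0 mulmx0.
    move/rowP => /(_ a); rewrite !mxE => vD0; rewrite -[RHS]vD0.
    by apply: eq_bigr => j _; rewrite !mxE horner_coef0.
  have [lt_t|ge_t] := ltnP t (row_degree Gh a); last first.
    by rewrite big1 // => j _; rewrite coef_row_degree ?mulr0.
  have [x <- <-] := reg_surj idxh lt_t.
  move/rowP: YBD => /(_ x); rewrite !mxE -/v => vC0; rewrite -[RHS]vC0.
  by apply: eq_bigr => j _; rewrite [_^T _ _]mxE (ccf_CE idxh).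
have vGh : map_mx polyC v *m Gh^T = 0.
  apply/rowP => a; rewrite !mxE; apply/polyP => m; rewrite coef0 coef_sum.
  by rewrite -[RHS](vE m a); apply: eq_bigr => j _; rewrite !mxE coefCM.
have [u vu] := bidual encG encGh vGh.
have red j m : (1 <= m)%N -> ((u *m G) 0 j)`_m = 0.
  by case: m => // m _; rewrite -vu mxE coefC.
have u0 := predictable_degree lead red.
have [[Gt GGt] _] := encG.
(* Both sides have the same product with D, which has a right inverse. *)
have YB : Y *m B^T = map_mx (horner_eval 0) u.
  have DGt : D *m map_mx (horner_eval 0) Gt = 1%:M.
    by rewrite -[D]/(map_mx (horner_eval 0) G) -map_mxM GGt map_mx1.
  rewrite -[LHS]mulmx1 -DGt mulmxA -/v -[RHS]mulmx1 -DGt mulmxA; congr (_ *m _).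
  rewrite -[D]/(map_mx (horner_eval 0) G) -map_mxM -vu.
  by apply/rowP => j; rewrite [RHS]mxE [in RHS]mxE /= /horner_eval hornerC.
rewrite -[Y]mulmx1 -(ccf_B_deg1 idx deg_le1) mulmxA YB.
apply/rowP => y; rewrite !mxE big1 // => a _; rewrite mxE (ccf_BE idx).
case: andP => [[/eqP -> _]|_]; last by rewrite mulr0.
rewrite /horner_eval horner_coef0 u0 ?mul0r // addn0.
exact: leq_ltn_trans (reg_lt idx y).
Qed.

Local Notation P := (- (Ch *m D^T *m B)).

Lemma row_free_P Eh : lead_rows Gh *m Eh = 1%:M -> row_free P.
Proof.
move=> leadh; apply: inj_row_free => X; rewrite mulmxN => /eqP.
rewrite oppr_eq0 => /eqP XP; apply: (dual_state_inj leadh).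
by rewrite -mulmxA -dual_CBB mulmxA XP mul0mx.
Qed.

Lemma row_free_trP E : lead_rows G *m E = 1%:M -> row_free P^T.
Proof.
move=> lead; have -> : P^T = - (B^T *m D *m Ch^T).
  by rewrite linearN /= !trmx_mul trmxK mulmxA.
apply: inj_row_free => Y; rewrite mulmxN !mulmxA => /eqP.
by rewrite oppr_eq0 => /eqP; apply: (dual_state_surj lead).
Qed.

(** By linearity this reduces to Ah P = Ch C^T and Bh P = Dh C^T, which are [dual_AC] and [dual_BC]
    multiplied by B. *)
Lemma dual_next_state (X : 'rV_e) (u : 'rV_l) :
  (X *m Ch + u *m Dh) *m Cc^T = (X *m Ah + u *m Bh) *m P.
Proof.
have CcE M (N : 'M_(M, n)) : N *m Cc^T = N *m (coef_mx G 1)^T *m B.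
  by rewrite coef_mx1E trmx_mul -!mulmxA (ccf_B_deg1 idx deg_le1) mulmx1.
have AP : Ah *m P = Ch *m Cc^T.
  by rewrite mulmxN 2!mulmxA dual_AC mulNmx opprK CcE.
have BP : Bh *m P = Dh *m Cc^T.
  by rewrite mulmxN 2!mulmxA dual_BC mulNmx opprK CcE.
by rewrite !mulmxDl -[X *m Ah *m _]mulmxA AP -[u *m Bh *m _]mulmxA BP !mulmxA.
Qed.

(** For the converse inclusion, the first equation puts x - X Ch in the kernel of D^T, which yields
    u; the second gives the next state after applying P, and [freeP] cancels P. *)
Lemma dual_output_set (X : 'rV_e) (Y : 'rV_e) : row_free P ->
  [set X *m Ch + u *m Dh | u : 'rV_l & Y == X *m Ah + u *m Bh] =
  [set x | (x *m D^T == - (X *m P *m B^T)) && (x *m Cc^T == Y *m P)].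
Proof.
move=> freeP.
have XPB : - (X *m P *m B^T) = X *m Ch *m D^T.
  by rewrite mulmxN mulNmx opprK -mulmxA dual_CBB mulmxA.
apply/setP => x; rewrite inE XPB; apply/imsetP/andP.
  case=> u; rewrite inE => /eqP -> ->; rewrite dual_next_state eqxx; split=> //.
  by rewrite mulmxDl -[u *m _ *m _]mulmxA conv0 mulmx0 addr0.
case=> /eqP xD /eqP xC.
have [u xu] : exists u : 'rV_l, x - X *m Ch = u *m Dh.
  by apply: (ker_ccf_D encG encGh); rewrite mulmxBl xD subrr.
have xE : x = X *m Ch + u *m Dh by rewrite -xu addrC subrK.
exists u => //; rewrite inE; apply/eqP/(row_free_inj freeP).
by rewrite -dual_next_state -xE xC.
Qed.

End DualPair.

(** * The MacWilliams identity for adjacency matrices with Forney indices at most 1 *)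

Theorem theorem5p10 (R : realType) (F : finFieldType) (p s : nat)
    (p_prime : prime p) (cardF : #|F| = (p ^ s)%N)
    (zeta : R[i]) (zeta_prim : p.-primitive_root zeta)
    (n k delta : nat)
    (C : 'rV[{poly F}]_n -> Prop) (codeC : conv_code k delta C)
    (G : 'M[{poly F}]_(k, n)) (minG : minimal_encoder C G)
    (ordG : zero_degrees_last G)
    (Gh : 'M[{poly F}]_(n - k, n)) (minGh : minimal_encoder (dual_code C) Gh)
    (ordGh : zero_degrees_last Gh)
    (delta_r : delta = num_nonzero_degrees G) :
  let L : 'M[{poly R[i]}]_(#|{: 'rV[F]_delta}|) := Lambda R[i] delta G in
  let Lh : 'M[{poly R[i]}]_(#|{: 'rV[F]_delta}|) := Lambda R[i] delta Gh in
  let P : 'M[F]_delta := - (ccf_C delta Gh *m (ccf_D G)^T *m ccf_B delta G) in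
  let H : 'M[R[i]]_(#|{: 'rV[F]_delta}|) := Hmx F p s zeta delta in
  let HLH : 'M[{poly R[i]}]_(#|{: 'rV[F]_delta}|) :=
    map_mx polyC H *m L^T *m map_mx polyC (invmx H) in
  let PP : 'M[R[i]]_(#|{: 'rV[F]_delta}|) := Pmx R[i] P in
  [/\ P \in unitmx,
      forall X Y : 'rV[F]_delta,
        entry Lh X Y =
          (#|F|%:R : R[i]) ^- k *:
            MacWilliams F n (entry HLH (X *m P) (Y *m P))
    & Lh = map_mx
        (fun f : {poly R[i]} => (#|F|%:R : R[i]) ^- k *: MacWilliams F n f)
        (map_mx polyC PP *m HLH *m map_mx polyC (invmx PP))].
Proof.
have [[[Gt GGt] spanG] degG] := minG; have [[basicGh _] degGh] := minGh.
have encG : encoder C G := proj1 minG.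
have encGh : encoder (dual_code C) Gh := proj1 minGh.
have sumG : (\sum_(i < k) row_degree G i)%N = delta.
  have [G' [encG' <-]] := codeC.
  by rewrite degG (minor_degree_encoder encG encG').
have deg_le1 i : (row_degree G i <= 1)%N.
  have le_pos l : true -> ((0 < row_degree G l)%N <= row_degree G l)%N.
    by case: (row_degree G l).
  (* Each indicator of a positive degree is at most that degree; equal sums, both delta, force
     equality term by term. *)
  have [_] := leqif_sum (fun l tl => leqif_eq (le_pos l tl)).
  have -> : (\sum_l (0 < row_degree G l) = delta)%N.
    by rewrite delta_r /num_nonzero_degrees -sum1dep_card [RHS]big_mkcond.
  rewrite sumG eqxx.
  by move/esym/forallP => /(_ i) /eqP <-; case: (0 < _)%N.
have [E lead] := lead_rows_free (proj1 encG) degG.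
have [Eh leadh] := lead_rows_free basicGh degGh.
have [i [r idx]] := state_index_exists sumG.
(* With the dual state space first taken in its own dimension, P is rectangular; independence of its
   rows and of its columns gives the two inequalities. *)
have sum_Gh : (\sum_(j < n - k) row_degree Gh j)%N = delta.
  have [ih [rh idxh]] := state_index_exists (erefl (\sum_j row_degree Gh j)%N).
  apply/eqP; rewrite eqn_leq; apply/andP; split.
    exact: (row_free_leq (row_free_P encG encGh idx idxh deg_le1 leadh)).
  exact: (row_free_leq (row_free_trP encG encGh idx idxh deg_le1 lead)).
have [ih [rh idxh]] := state_index_exists sum_Gh.
move=> L Lh P H HLH PP.
have freeP : row_free P := row_free_P encG encGh idx idxh deg_le1 leadh.
have unitP : P \in unitmx by rewrite -row_free_unit.
have D_inj : injective (mulmx^~ (ccf_D G) : 'rV_k -> 'rV_n).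
  have DGt : ccf_D G *m map_mx (horner_eval 0) Gt = 1%:M.
    by rewrite -[ccf_D G]/(map_mx (horner_eval 0) G) -map_mxM GGt map_mx1.
  move=> u v /(congr1 (mulmx^~ (map_mx (horner_eval 0) Gt))).
  by rewrite -!mulmxA DGt !mulmx1.
have q0 : #|F|%:R != 0 :> R[i].
  by rewrite pnatr_eq0 cardF expn_eq0 -leqn0 leqNgt prime_gt0.
have main X Y : entry Lh X Y =
    #|F|%:R ^- k *: MacWilliams F n (entry HLH (X *m P) (Y *m P)).
  (* A = 0 brings [L] into the form of [MacWilliams_entry]; the factor q^k then cancels q^-k. *)
  rewrite /HLH /L /Lambda (ccf_A_deg1 idx deg_le1).
  rewrite (MacWilliams_entry p_prime cardF zeta_prim) // scalerA.
  rewrite mulVf ?expf_neq0 //.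
  rewrite scale1r entry_mx_of_states.
  by rewrite (dual_output_set encG encGh idx idxh deg_le1).
split=> //.
have invPP : invmx PP = Pmx R[i] (invmx P).
  have PPV : PP *m Pmx R[i] (invmx P) = 1%:M.
    apply: entry_inj => X Y; rewrite entry_mul entry1.
    rewrite (bigD1 (X *m P)) //= !entry_mx_of_states eqxx mul1r mulmxK //.
    rewrite big1 ?addr0 => [|Z ne_Z]; first by rewrite eq_sym.
    by rewrite entry_mx_of_states (negbTE ne_Z) mul0r.
  have [unitPP _] := mulmx1_unit PPV.
  by rewrite -[RHS](mulKmx unitPP) PPV mulmx1.
(* In conjugation by the permutation matrix, only the intermediate states XP and YP contribute to
   entry (X, Y). *)
clearbody HLH; apply: entry_inj => X Y; rewrite main entry_map.
congr (_ *: MacWilliams F n _).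
rewrite invPP entry_mul (bigD1 (Y *m P)) //= entry_map entry_mx_of_states.
rewrite mulmxK // eqxx mulr1 [X in _ + X]big1 ?addr0 => [|Z ne_Z]; last first.
  rewrite entry_map entry_mx_of_states; case: eqP => [YZ|_]; last by rewrite mulr0.
  by case/eqP: ne_Z; rewrite YZ mulmxKV.
rewrite entry_mul (bigD1 (X *m P)) //= entry_map entry_mx_of_states eqxx mul1r.
rewrite big1 ?addr0 // => Z ne_Z.
by rewrite entry_map entry_mx_of_states (negbTE ne_Z) mul0r.
Qed.
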